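(* Let $d,m\geq1$ be integers. For any $\sigma\in NC^*_2(d,m)$ there are less than $4^{2m}$ partitions $\pi\in NC^*(d,m)$ such that $\mathcal{P}(\pi)=\mathcal{P}(\sigma)$. Moreover, for such a $\pi$, the partition $\sigma$ is finer than $\pi$, the number of blocks of $\pi$ of size $2$ is greater than $dm-2m$, and every block of $\pi$ has size at most $2m$.
   Context: For an integer $n$, $[n]=\{1,\dots,n\}$. For a partition $\pi$, $i\sim_\pi j$ means $i$ and $j$ lie in the same block. A partition of $[n]$ is non-crossing if for distinct $i<j<k<l$, $i\sim_\pi k$ and $j\sim_\pi l$ imply $i\sim_\pi j$. The set $[2dm]$ is divided into $2m$ intervals $J_k=\{(k-1)d+1,\dots,kd\}$, $1\leq k\leq2m$. The elements of $J_k$ are labelled in order from $1$ to $d$ if $k$ is odd and from $d$ to $1$ if $k$ is even; $A_i$ is the set of elements of $[2dm]$ with label $i$. $NC^*(d,m)$ is the set of non-crossing partitions of $[2dm]$ all of whose blocks have even cardinality and such that within each block any two consecutive elements belong to intervals $J_k,J_{k'}$ with $k\not\equiv k'\pmod2$; $NC_2^*(d,m)$ is the subset of those with all blocks of size $2$. Each $\pi\in NC^*(d,m)$ connects only elements with the same label, so it restricts to partitions $\pi|_{A_i}$; identifying $A_i$ with $[2m]$ (the element of $A_i\cap J_k$ corresponds to $k$), $\pi|_{A_i}\in NC^*(1,m)$, the set of non-crossing partitions of $[2m]$ with blocks of even size. For $\rho\in NC^*(1,m)$, $\Phi(\rho)$ is the partition of $[m]$ obtained by identifying $2k-1$ and $2k$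 in $[2m]$ to get $k\in[m]$: $\sim_{\Phi(\rho)}$ is the transitive closure of the relation relating $k$ and $l$ if some element of $\{2k-1,2k\}$ is $\sim_\rho$ some element of $\{2l-1,2l\}$. For $\pi\in NC^*(d,m)$, $\mathcal{P}(\pi)=(\Phi(\pi|_{A_1}),\dots,\Phi(\pi|_{A_d}))$. *)

(* Defs.v *)
From mathcomp Require Import all_boot all_order all_algebra.

Set Implicit Arguments.
Unset Strict Implicit.
Unset Printing Implicit Defensive.

(* Partitions of [n] are elements of {set {set 'I_n}}.  All indices start at  *)
(* 0: the ordinal x stands for x + 1 in [n], the interval J_(k+1) is the set  *)
(* of x with x %/ d = k, and the labels range over 0, ..., d - 1.             *)

Definition same_block (T : finType) (pi : {set {set T}}) : rel T :=
  fun x y => [exists B in pi, (x \in B) && (y \in B)].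

Definition finer (T : finType) (sigma pi : {set {set T}}) : bool :=
  [forall A in sigma, exists B in pi, A \subset B].

Definition noncrossing (n : nat) (pi : {set {set 'I_n}}) : bool :=
  [forall i : 'I_n, forall j : 'I_n, forall k : 'I_n, forall l : 'I_n,
    [&& i < j, j < k, k < l, same_block pi i k & same_block pi j l]
      ==> same_block pi i j].

Definition consecutive (n : nat) (B : {set 'I_n}) (x y : 'I_n) : bool :=
  [&& x \in B, y \in B, x < y & [forall z in B, ~~ (x < z < y)]].

(* J_k with k odd (labelled increasingly) is the set x %/ d = k - 1, an even  *)
(* quotient.                                                                  *)
Definition label (d x : nat) : nat :=
  if odd (x %/ d) then d.-1 - x %% d else x %% d.

Definition NCstar (d m : nat) : {set {set {set 'I_(2 * d * m)}}} :=
  [set pi | [&& partition pi [set: 'I_(2 * d * m)],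
                noncrossing pi,
                [forall B in pi, ~~ odd #|B|]
              & [forall B in pi, forall x, forall y, consecutive B x y ==>
                  (odd (x %/ d) != odd (y %/ d))]]].

Definition NC2star (d m : nat) : {set {set {set 'I_(2 * d * m)}}} :=
  [set pi in NCstar d m | [forall B in pi, #|B| == 2]].

(* The restriction of pi to A_i, where the element of A_i lying in the k-th   *)
(* interval is identified with k; the traces of blocks missing A_i are        *)
(* discarded.                                                                 *)
Definition restr_label (d m : nat) (pi : {set {set 'I_(2 * d * m)}})
    (i : 'I_d) : {set {set 'I_(2 * m)}} :=
  [set [set k : 'I_(2 * m) | [exists x in B,
          (label d x == i) && (x %/ d == k)]] | B : {set 'I_(2 * d * m)} in pi]
    :\ set0.

(* On indices starting at 0, x./2 sends 2k and 2k + 1 to k; this is the       *)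
(* identification of 2k - 1 and 2k on [2m].                                   *)
Definition Phi_rel (m : nat) (rho : {set {set 'I_(2 * m)}}) : rel 'I_m :=
  fun k l => [exists x : 'I_(2 * m), exists y : 'I_(2 * m),
    [&& x./2 == k, y./2 == l & same_block rho x y]].

Definition Phi (m : nat) (rho : {set {set 'I_(2 * m)}}) : {set {set 'I_m}} :=
  equivalence_partition (connect (Phi_rel rho)) [set: 'I_m].

Definition calP (d m : nat) (pi : {set {set 'I_(2 * d * m)}}) :
    {ffun 'I_d -> {set {set 'I_m}}} :=
  [ffun i => Phi (restr_label pi i)].

(* Main.v *)
Require Import Defs.
From mathcomp Require Import all_boot all_order all_algebra zify.

Set Implicit Arguments.
Unset Strict Implicit.
Unset Printing Implicit Defensive.

(** Call an element of J_q going up when the labels of J_q increase, and going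
    down otherwise.  Blocks of a partition in NC*(d, m) alternate between up
    and down elements, also cyclically because they have even size.  A gap
    between two consecutive elements of a block is a union of blocks, hence
    contains as many up as down elements, and the height of the resulting walk
    shows that the label is constant on each block ([label_same_block]).  So a
    block has at most one element in each of the 2m intervals.

    Let pi have the same image under P as the pairing sigma, and let x be a
    down element, of label i.  The cyclic successor y of x in its pi-block is
    an up element of label i, and the elements of label i in the gap from x to
    y form whole pairs J_(2k-1), J_(2k).  The gap being a union of blocks, the
    group of y is the first one after that of x in its class of Phi(pi|A_i).
    As the same holds for sigma, the pi-successor of x is its sigma-partner
    ([down_cnext]).  Hence sigma is finer than pi ([pair_same_block]); a down
    element that is the larger one of its pair is the maximum of its pi-block,
    and an up element that is the smaller one is the minimum of its pi-block.

    So pi and sigma differ only in the up elements which are a maximum for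
    sigma and not for pi, and in the down elements which are a minimum for
    sigma and not for pi.  Each interval has at most one such element: if x' in
    J_q is not the maximum of its pi-block, then every x > x' of J_q lies in
    the gap that follows x', so that its sigma-partner, outside J_q, is larger
    than x ([not_block_max_right]); minima are symmetric.  The position of this
    element in J_q is moreover the same for all pi ([changed_unique]).  A
    non-crossing partition is determined by the maxima and the minima of its
    blocks ([eq_noncrossing]), so pi is determined by a subset of the 2m
    intervals, which leaves at most 2^(2m) partitions.

    Finally the number of blocks of pi is its number of block maxima.  It is at
    least dm - (m - 1), because at most one maximum is lost in each interval of
    up elements and none in the first one, where an element has no smaller
    partner.  All blocks having even size, this bounds the number of blocks of
    size other than 2. *)

(** * Partitions and their blocks *)

Lemma same_blockE (T : finType) (pi : {set {set T}}) (x y : T) :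
  partition pi [set: T] -> same_block pi x y = (y \in pblock pi x).
Proof.
move=> /and3P[/eqP cov triv _].
have xc : x \in cover pi by rewrite cov inE.
apply/idP/idP => [/exists_inP[B Bpi /andP[xB yB]]|yx].
  by rewrite (def_pblock triv Bpi xB).
by apply/exists_inP; exists (pblock pi x); rewrite ?pblock_mem // mem_pblock xc.
Qed.

Lemma same_block_refl (T : finType) (pi : {set {set T}}) (x : T) :
  partition pi [set: T] -> same_block pi x x.
Proof.
by move=> P; rewrite same_blockE // mem_pblock (cover_partition P) inE.
Qed.

Lemma same_block_sym (T : finType) (pi : {set {set T}}) :
  symmetric (same_block pi).
Proof.
by move=> x y; apply: eq_existsb => B; rewrite [(x \in B) && _]andbC.
Qed.

Lemma same_block_trans (T : finType) (pi : {set {set T}}) :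
  partition pi [set: T] -> transitive (same_block pi).
Proof.
move=> P y x z; rewrite !same_blockE // => xy yz.
have [_ triv _] := and3P P.
by rewrite -(same_pblock triv xy).
Qed.

Lemma same_block_mem (T : finType) (pi : {set {set T}}) (B : {set T}) (x y : T) :
  partition pi [set: T] -> B \in pi -> x \in B -> same_block pi x y = (y \in B).
Proof.
move=> P Bpi xB; rewrite same_blockE //.
by have [_ triv _] := and3P P; rewrite (def_pblock triv Bpi xB).
Qed.

Lemma same_block_inj (T : finType) (pi rho : {set {set T}}) :
  partition pi [set: T] -> partition rho [set: T] ->
  same_block pi =2 same_block rho -> pi = rho.
Proof.
have sub (p r : {set {set T}}) : partition p [set: T] -> partition r [set: T] ->
    same_block p =2 same_block r -> {subset p <= r}.
  move=> P R E B Bp; have [_ _ n0] := and3P P.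
  have /set0Pn[x xB] : B != set0 by apply: contraNneq n0 => <-.
  suff -> : B = pblock r x by rewrite pblock_mem // (cover_partition R) inE.
  by apply/setP=> y; rewrite -same_blockE // -E (same_block_mem _ P Bp).
move=> P R E; apply/eqP; rewrite eqEsubset.
by apply/andP; split; apply/subsetP; apply: sub.
Qed.

(** * Successors in the blocks of a non-crossing partition *)

Lemma noncrossingP (n : nat) (pi : {set {set 'I_n}}) (i j k l : 'I_n) :
  noncrossing pi -> i < j -> j < k -> k < l ->
  same_block pi i k -> same_block pi j l -> same_block pi i j.
Proof.
move=> /forallP/(_ i)/forallP/(_ j)/forallP/(_ k)/forallP/(_ l)/implyP H.
by move=> ij jk kl ik jl; apply: H; rewrite ij jk kl ik.
Qed.

(** [z] lies strictly between [x] and [y] when going cyclically upwards from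
    [x] to [y].  For [y = x] this means every [z] other than [x]. *)
Definition in_gap (x y z : nat) : bool :=
  if x < y then x < z < y else (z < y) || (x < z).

(** [y] is the cyclic successor of [x] in its block: the next larger element,
    or the minimum of the block when [x] is its maximum. *)
Definition cnext (n : nat) (pi : {set {set 'I_n}}) (x y : 'I_n) : Prop :=
  same_block pi x y /\ forall z, same_block pi x z -> ~~ in_gap x y z.

(** [x] is the maximum of its block; [block_min] is the minimum. *)
Definition block_max (n : nat) (pi : {set {set 'I_n}}) (x : 'I_n) : bool :=
  [forall y, same_block pi x y ==> (y <= x)].

Definition block_min (n : nat) (pi : {set {set 'I_n}}) (x : 'I_n) : bool :=
  [forall y, same_block pi x y ==> (x <= y)].

Lemma cnext_gt (n : nat) (pi : {set {set 'I_n}}) (x : 'I_n) :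
  ~~ block_max pi x -> exists2 y : 'I_n, x < y & cnext pi x y.
Proof.
rewrite negb_forall => /existsP[y0]; rewrite negb_imply -ltnNge => y0P.
case: (arg_minnP (P := [pred y | same_block pi x y && (x < y)])
         (fun y : 'I_n => nat_of_ord y) y0P) => y /= /andP[xy lt] ymin.
exists y => //; split=> // z xz; rewrite /in_gap lt.
by apply/negP => /andP[xltz]; rewrite ltnNge ymin // xz.
Qed.

Lemma cnext_exists (n : nat) (pi : {set {set 'I_n}}) (x : 'I_n) :
  partition pi [set: 'I_n] -> exists y : 'I_n, cnext pi x y.
Proof.
move=> P; have [/forallP xmax|/cnext_gt[y _ nxy]] := boolP (block_max pi x);
  last by exists y.
case: (arg_minnP (P := same_block pi x)
         (fun y : 'I_n => nat_of_ord y) (same_block_refl x P)) => y /= xy ymin.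
have := xmax y; rewrite xy /= => yx.
exists y; split=> // z xz; rewrite /in_gap ltnNge yx /= negb_or -!leqNgt ymin //=.
by have := xmax z; rewrite xz.
Qed.

Lemma cnext_lt (n : nat) (pi : {set {set 'I_n}}) (y : 'I_n) :
  partition pi [set: 'I_n] ->
  ~~ block_min pi y -> exists2 x : 'I_n, x < y & cnext pi x y.
Proof.
move=> P; rewrite negb_forall => /existsP[y0]; rewrite negb_imply -ltnNge => y0P.
case: (arg_maxnP (P := [pred x : 'I_n | same_block pi y x && (x < y)])
         (fun y : 'I_n => nat_of_ord y) y0P) => x /= /andP[yx lt] xmax.
exists x => //; split=> [|z xz]; first by rewrite same_block_sym.
rewrite /in_gap lt; apply/negP => /andP[xltz zlty].
have := xmax z; rewrite zlty (same_block_trans P yx xz) => /(_ isT).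
by rewrite /= leqNgt xltz.
Qed.

(** The gap between an element and its cyclic successor is a union of blocks. *)
Lemma gap_closed (n : nat) (pi : {set {set 'I_n}}) (x y z w : 'I_n) :
  partition pi [set: 'I_n] -> noncrossing pi ->
  cnext pi x y -> in_gap x y z -> same_block pi z w -> in_gap x y w.
Proof.
move=> P N [xy G] zg zw; apply/negPn/negP => wg.
have T := same_block_trans P; have S := same_block_sym pi.
have nxz : ~~ same_block pi x z by apply/negP => /G; rewrite zg.
have nxw : ~~ same_block pi x w.
  by apply: contra nxz => /T; apply; rewrite S.
have nyw : ~~ same_block pi y w by apply: contra nxw; apply: T.
have nyz : ~~ same_block pi y z by apply: contra nxz; apply: T.
have wx : (w != x :> nat).
  by apply/negP => /eqP/val_inj E; move: nxw; rewrite E same_block_refl.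
have wy : (w != y :> nat).
  by apply/negP => /eqP/val_inj E; move: nyw; rewrite E same_block_refl.
have yx : same_block pi y x by rewrite S.
have wz : same_block pi w z by rewrite S.
move: zg wg; rewrite /in_gap; case: ltnP => [lt /andP[xz zy] wg|le zg wg].
  have [wltx|ylew] : w < x \/ y < w by move: wg wx wy; clear; lia.
    by move: nxw; rewrite S (noncrossingP N wltx xz zy wz xy).
  by move: nxz; rewrite (noncrossingP N xz zy ylew xy zw).
have [yw wltx] : y < w /\ w < x by move: wg wx wy; clear; lia.
have [zy|xz] : z < y \/ x < z by apply/orP.
  by move: nyz; rewrite S (noncrossingP N zy yw wltx zw yx).
by move: nyw; rewrite (noncrossingP N yw wltx xz yx wz).
Qed.

(** Induction on [y - x]: if the [rho]-successor of [x] is some [y' <> y], the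
    smaller one of [y] and [y'] is not a block minimum, and the predecessor of
    this element for the partition in which it lies in the gap contradicts the
    induction hypothesis. *)
Lemma cnext_transfer (n : nat) (pi rho : {set {set 'I_n}}) (x y : 'I_n) :
  partition pi [set: 'I_n] -> partition rho [set: 'I_n] ->
  noncrossing pi -> noncrossing rho ->
  block_max pi =1 block_max rho -> block_min pi =1 block_min rho ->
  x < y -> cnext pi x y -> cnext rho x y.
Proof.
move=> P R NP NR Emax Emin.
have [k] := ubnP (y - x).
elim: k pi rho P R NP NR Emax Emin x y =>
  // k IH pi rho P R NP NR Emax Emin x y lek xy nxy.
have nmin_y p (r q : 'I_n) : cnext p r q -> r < q -> ~~ block_min p q.
  move=> [rq _] lt; apply/negP => /forallP/(_ r).
  by rewrite same_block_sym rq /= leqNgt lt.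
have : ~~ block_max rho x.
  rewrite -Emax; apply/negP => /forallP/(_ y); case: nxy => -> _ /=.
  by rewrite leqNgt xy.
case/cnext_gt => y' xy' nxy'.
(* p is the partition for which z lies in the gap after x. *)
have inner p r (z z' : 'I_n) : partition p [set: 'I_n] ->
    partition r [set: 'I_n] -> noncrossing p ->
    cnext p x z' -> x < z -> z < z' -> ~~ block_min p z -> cnext r x z ->
    (forall w : 'I_n, x < w -> w < z -> cnext p w z -> cnext r w z) -> False.
  move=> Pp Pr Np nz' xz zz' /(cnext_lt Pp)[w wz nwz] [rxz rg] step.
  have xw : x < w.
    have /(gap_closed Pp Np nz') : in_gap x z' z.
      by rewrite /in_gap (ltn_trans xz zz') xz.
    case: nwz => wzs _ /(_ w); rewrite same_block_sym => /(_ wzs).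
    by rewrite /in_gap (ltn_trans xz zz') => /andP[].
  have := step w xw wz nwz; case=> rwz _.
  have /rg : same_block r x w.
    by apply: (same_block_trans Pr rxz); rewrite same_block_sym.
  by rewrite /in_gap xz xw wz.
have [lt|lt|/val_inj E] := ltngtP y y'; last by rewrite E.
  exfalso; apply: (inner rho pi y y') => //.
    by rewrite -Emin; apply: nmin_y nxy xy.
  move=> w xw wy; apply: IH => //; lia.
exfalso; apply: (inner pi rho y' y) => //.
  by rewrite Emin; apply: nmin_y nxy' xy'.
move=> w xw wy; apply: IH => //; lia.
Qed.

(** A non-crossing partition is determined by the maxima and the minima of its
    blocks. *)
Lemma eq_noncrossing (n : nat) (pi rho : {set {set 'I_n}}) :
  partition pi [set: 'I_n] -> partition rho [set: 'I_n] ->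
  noncrossing pi -> noncrossing rho ->
  block_max pi =1 block_max rho -> block_min pi =1 block_min rho -> pi = rho.
Proof.
have sub p r : partition p [set: 'I_n] -> partition r [set: 'I_n] ->
    noncrossing p -> noncrossing r ->
    block_max p =1 block_max r -> block_min p =1 block_min r ->
    forall x y : 'I_n, x <= y -> same_block p x y -> same_block r x y.
  move=> P R NP NR Emax Emin x y; have [k] := ubnP (y - x).
  elim: k x => // k IH x lek; rewrite leq_eqVlt => /orP[/eqP/val_inj->|xy pxy].
    by move=> _; apply: same_block_refl.
  have /cnext_gt[z xz nxz] : ~~ block_max p x.
    by apply/negP => /forallP/(_ y); rewrite pxy leqNgt xy.
  have [rxz _] := cnext_transfer P R NP NR Emax Emin xz nxz.
  case: nxz => pxz /(_ _ pxy); rewrite /in_gap xz xy -leqNgt => zy.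
  apply: (same_block_trans R rxz); apply: IH => //; first by lia.
  by apply: (same_block_trans P _ pxy); rewrite same_block_sym.
move=> P R NP NR Emax Emin; apply: same_block_inj => // x y.
have [le|/ltnW le] := leqP x y; last first.
  by rewrite same_block_sym [RHS]same_block_sym; apply/idP/idP; apply: sub.
by apply/idP/idP; apply: sub.
Qed.

(** * Alternation of up and down elements in a block *)

(** In an alternating list [p] and its negation occur equally often, up to a
    correction by the head in odd length. *)
Lemma alt_count (T : Type) (p : pred T) (x : T) (s : seq T) :
  path (fun a b => p a != p b) x s ->
  count p (x :: s) + (~~ odd (size s) && ~~ p x)
    = count (predC p) (x :: s) + (~~ odd (size s) && p x).
Proof.
elim: s x => [|y s IH] x /=; first by case: (p x).
move=> /andP[pxy /IH] /=.
by case: (odd (size s)); case: (p x) pxy; case: (p y) => //= _; lia.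
Qed.

Lemma alt_last (T : Type) (p : pred T) (x : T) (s : seq T) :
  path (fun a b => p a != p b) x s -> p (last x s) = p x (+) odd (size s).
Proof.
elim: s x => [|y s IH] x /=; first by rewrite addbF.
by move=> /andP[pxy /IH->]; case: (p x) pxy; case: (p y); case: odd.
Qed.

Lemma sorted_enum_set (n : nat) (B : {set 'I_n}) :
  sorted (fun x y : 'I_n => x < y) (enum B).
Proof.
rewrite {1}/enum_mem -enumT; apply: sorted_filter.
  by move=> y x z; apply: ltn_trans.
by have := iota_ltn_sorted 0 n; rewrite -val_enum_ord sorted_map.
Qed.

Lemma sorted_consecutive (n : nat) (B : {set 'I_n}) (e : rel 'I_n) :
  (forall x y, consecutive B x y -> e x y) -> sorted e (enum B).
Proof.
move=> H; have S := sorted_enum_set B.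
have tr : transitive (fun x y : 'I_n => x < y) by move=> y x z; apply: ltn_trans.
case E: (enum B) => [|x0 s] //; rewrite -E.
apply/(sortedP x0) => i lti; apply: H; apply/and4P; split.
- by rewrite -mem_enum mem_nth // ltnW.
- by rewrite -mem_enum mem_nth.
- by move/(sortedP x0): (S) => /(_ _ lti).
apply/forall_inP => z; rewrite -mem_enum => zB; apply/negP.
have mono := sorted_ltn_nth tr x0 S.
have lti' : i < size (enum B) by rewrite ltnW.
have zS : index z (enum B) < size (enum B) by rewrite index_mem.
rewrite -{1 2}(nth_index x0 zB) => /andP[xz zy].
have [lt|lt|eqi] := ltngtP (index z (enum B)) i.
- by have /ltn_trans/(_ xz) := mono _ _ zS lti' lt; rewrite ltnn.
- have [lt2|eqi] : i.+1 < index z (enum B) \/ index z (enum B) = i.+1 by lia.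
    by have /ltn_trans/(_ zy) := mono _ _ lti zS lt2; rewrite ltnn.
  by move: zy; rewrite eqi ltnn.
by move: xz; rewrite eqi ltnn.
Qed.

(** The element [x] lies in an interval whose labels increase (intervals are
    numbered from 0). *)
Definition up (d x : nat) : bool := ~~ odd (x %/ d).

Lemma NCstarP (d m : nat) (pi : {set {set 'I_(2 * d * m)}}) :
  pi \in NCstar d m ->
  [/\ partition pi [set: 'I_(2 * d * m)], noncrossing pi,
      forall B : {set 'I_(2 * d * m)}, B \in pi -> ~~ odd #|B| &
      forall (B : {set 'I_(2 * d * m)}) x y, B \in pi -> consecutive B x y ->
        up d x != up d y].
Proof.
rewrite inE => /and4P[P N /forall_inP E /forall_inP C]; split=> // B x y Bpi xy.
have /forallP/(_ x)/forallP/(_ y)/implyP/(_ xy) := C B Bpi.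
by rewrite /up; case: odd; case: odd.
Qed.

Lemma block_sorted (d m : nat) (pi : {set {set 'I_(2 * d * m)}}) B :
  pi \in NCstar d m -> B \in pi ->
  sorted (fun x y : 'I_(2 * d * m) => up d x != up d y) (enum B).
Proof.
move=> /NCstarP[_ _ _ C] Bpi; apply: sorted_consecutive => x y; exact: C.
Qed.

Lemma block_balanced (d m : nat) (pi : {set {set 'I_(2 * d * m)}}) B :
  pi \in NCstar d m -> B \in pi ->
  \sum_(x in B) up d x = \sum_(x in B) ~~ up d x.
Proof.
move=> pi_in Bpi; have := block_sorted pi_in Bpi.
have [_ _ E _] := NCstarP pi_in; have := E B Bpi.
have cnt (p : pred 'I_(2 * d * m)) : \sum_(x in B) p x = count p (enum B).
  rewrite -big_enum /= -sum1_count [RHS]big_mkcond /=.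
  by apply: eq_bigr => x _; case: (p x).
rewrite cardE (cnt (fun x => up d x)) (cnt (fun x => ~~ up d x)).
case: (enum B) => [|x s] // os alt.
have := alt_count (p := fun x : 'I_(2 * d * m) => up d x) alt.
by move: os => /=; rewrite negbK => ->; rewrite /= !addn0.
Qed.

Lemma block_max_min_up (d m : nat) (pi : {set {set 'I_(2 * d * m)}}) x y :
  pi \in NCstar d m -> block_max pi x -> block_min pi y -> same_block pi x y ->
  up d x != up d y.
Proof.
move=> pi_in xmax ymin xy; have [P _ E _] := NCstarP pi_in.
have lt_trans : transitive (fun a b : 'I_(2 * d * m) => a < b).
  by move=> b a c; apply: ltn_trans.
case/exists_inP: (xy) => B Bpi /andP[xB yB].
have := block_sorted pi_in Bpi; have := E B Bpi; rewrite cardE.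
have := sorted_enum_set B; rewrite (sorted_pairwise lt_trans).
have memx w : (w \in enum B) = same_block pi x w.
  by rewrite mem_enum (same_block_mem _ P Bpi).
have memy w : (w \in enum B) = same_block pi y w.
  by rewrite mem_enum (same_block_mem _ P Bpi).
case: (enum B) memx memy => [|z s] memx memy S os alt.
  by have := memx x; rewrite same_block_refl.
have zy : z = y.
  apply/val_inj/eqP; rewrite eqn_leq.
  have /implyP-> := forallP ymin z; last by rewrite -memy mem_head.
  have : y \in z :: s by rewrite memy same_block_refl.
  rewrite inE andbT => /orP[/eqP->//|ys].
  by move: S => /= /andP[/allP/(_ y ys)/ltnW].
have lx : last z s = x.
  apply/val_inj/eqP; rewrite eqn_leq.
  have /implyP-> /= := forallP xmax (last z s); last by rewrite -memx mem_last.
  have : x \in rcons (belast z s) (last z s).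
    by rewrite -lastI memx same_block_refl.
  rewrite mem_rcons inE => /orP[/eqP->//|xs].
  by move: S; rewrite lastI pairwise_rcons => /andP[/allP/(_ x xs)/ltnW].
have := alt_last (p := fun x : 'I_(2 * d * m) => up d x) alt.
rewrite lx zy => ->; move: os => /=; rewrite negbK => ->.
by case: (up d y).
Qed.

(** Alternation is cyclic, as blocks have even size. *)
Lemma cnext_up (d m : nat) (pi : {set {set 'I_(2 * d * m)}}) x y :
  pi \in NCstar d m -> cnext pi x y -> up d x != up d y.
Proof.
move=> pi_in nxy; have [P _ _ C] := NCstarP pi_in.
have [lt|le] := ltnP x y.
  case: (nxy) => /exists_inP[B Bpi /andP[xB yB]] G; apply: (C B) => //.
  rewrite /consecutive xB yB lt /=; apply/forall_inP => z zB.
  by have := G z; rewrite (same_block_mem _ P Bpi xB) zB /in_gap lt; apply.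
have [xy G] := nxy; apply: (block_max_min_up pi_in) => //.
  apply/forallP=> z; apply/implyP => /G.
  by rewrite /in_gap ltnNge le /= negb_or -!leqNgt => /andP[].
apply/forallP=> z; apply/implyP => yz; have /G : same_block pi x z.
  exact: same_block_trans xy yz.
by rewrite /in_gap ltnNge le /= negb_or -!leqNgt => /andP[].
Qed.

(** * Constancy of the label on blocks *)

(** The height, just before [x], of the walk that steps up at up elements and
    down at down elements: it oscillates between 0 and [d]. *)
Definition height (d x : nat) : nat :=
  if up d x then x %% d else d - x %% d.

Lemma heightS (d x : nat) :
  0 < d -> height d x.+1 + ~~ up d x = height d x + up d x.
Proof.
move=> d0; rewrite /height /up.
have rd := ltn_pmod x d0; have := divn_eq x d.
move: (x %/ d) (x %% d) rd => q r rd ->.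
have [lt|le] := ltnP r.+1 d.
  rewrite -addnS divnMDl // modnMDl divn_small // modn_small // addn0.
  by case: (odd q) => /=; lia.
have -> : (q * d + r).+1 = q.+1 * d by rewrite mulSn; lia.
by rewrite mulnK // modnMl /=; case: (odd q) => /=; lia.
Qed.

Lemma height_sum (d a b : nat) : 0 < d -> a <= b ->
  height d b + \sum_(a <= z < b) ~~ up d z = height d a + \sum_(a <= z < b) up d z.
Proof.
move=> d0; elim: b => [|b IH]; first by rewrite leqn0 => /eqP->; rewrite !big_geq.
rewrite leq_eqVlt => /orP[/eqP->|ab]; first by rewrite !big_geq.
rewrite !big_nat_recr //=; have := IH ab; have := heightS b d0; lia.
Qed.

Lemma label_height (d x : nat) : 0 < d ->
  height d x = if up d x then label d x else (label d x).+1.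
Proof.
by move=> d0; rewrite /height /label /up; have := ltn_pmod x d0; case: odd => /=; lia.
Qed.

Lemma gap_balanced (d m : nat) (pi : {set {set 'I_(2 * d * m)}})
    (x y : 'I_(2 * d * m)) :
  pi \in NCstar d m -> x < y -> cnext pi x y ->
  \sum_(x.+1 <= z < y) up d z = \sum_(x.+1 <= z < y) ~~ up d z.
Proof.
move=> pi_in xy nxy; have [P N _ _] := NCstarP pi_in.
(* G is the gap and Q the set of the blocks contained in it. *)
pose G := [set z : 'I_(2 * d * m) | in_gap x y z].
pose Q := [set B in pi | B \subset G].
have covQ : cover Q = G.
  apply/setP=> z; apply/bigcupP/idP => [[B]|zG].
    by rewrite inE => /andP[_ /subsetP sB] /sB.
  have zc : z \in cover pi by rewrite (cover_partition P) inE.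
  exists (pblock pi z); last by rewrite mem_pblock.
  rewrite inE pblock_mem //=; apply/subsetP=> w; rewrite -same_blockE // !inE.
  by apply: gap_closed nxy _ => //; move: zG; rewrite inE.
have trivQ : trivIset Q.
  have [_ + _] := and3P P; apply: trivIsetS; apply/subsetP=> B.
  by rewrite inE => /andP[].
have toG (F : nat -> nat) : \sum_(x.+1 <= z < y) F z = \sum_(z in G) F z.
  rewrite (big_nat_widen _ _ (2 * d * m)); last exact: ltnW.
  rewrite big_geq_mkord /=; apply: eq_bigl => z.
  by rewrite inE /in_gap xy andbC.
rewrite (toG (fun z => up d z)) (toG (fun z => ~~ up d z)) -covQ.
rewrite !big_trivIset //; apply: eq_bigr => B; rewrite inE => /andP[Bpi _].
exact: (block_balanced pi_in Bpi).
Qed.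

(** The walk has the same height after [x] and before the next element of its
    block, which goes in the other direction: the two steps have the same
    label. *)
Lemma label_same_block (d m : nat) (pi : {set {set 'I_(2 * d * m)}})
    (x y : 'I_(2 * d * m)) :
  0 < d -> pi \in NCstar d m -> same_block pi x y -> label d x = label d y.
Proof.
move=> d0 pi_in; have [P N _ _] := NCstarP pi_in.
wlog le : x y / x <= y.
  move=> W xy; have [le|/ltnW le] := leqP x y; first exact: W.
  by apply/esym/W => //; rewrite same_block_sym.
have [k] := ubnP (y - x); elim: k x le => // k IH x.
rewrite leq_eqVlt => /orP[/eqP/val_inj->//|xy] lek pxy.
have /cnext_gt[z xz nxz] : ~~ block_max pi x.
  by apply/negP => /forallP/(_ y); rewrite pxy leqNgt xy.
have -> : label d x = label d z.
  have := height_sum d0 xz; have := gap_balanced pi_in xz nxz.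
  have := heightS x d0; have := cnext_up pi_in nxz.
  rewrite !label_height //.
  by case: (up d x); case: (up d z) => //=; lia.
case: nxz => pxz /(_ _ pxy); rewrite /in_gap xz xy -leqNgt => zy.
apply: IH => //; first by lia.
by apply: (same_block_trans P _ pxy); rewrite same_block_sym.
Qed.

(** * The partitions Phi(pi|A_i) *)

Lemma divn_lt (d m : nat) (x : 'I_(2 * d * m)) : x %/ d < 2 * m.
Proof.
case: x => x lt /=; have d0 : 0 < d by case: d lt => //; rewrite muln0 mul0n.
by rewrite ltn_divLR // -mulnA [m * d]mulnC mulnA.
Qed.

Lemma label_lt (d x : nat) : 0 < d -> label d x < d.
Proof. by move=> d0; have := ltn_pmod x d0; rewrite /label; case: odd; lia. Qed.

Lemma label_inj (d x y : nat) :
  0 < d -> x %/ d = y %/ d -> label d x = label d y -> x = y.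
Proof.
move=> d0 E; rewrite /label E => L; rewrite (divn_eq x d) (divn_eq y d) E.
congr (_ + _); move: L; have := ltn_pmod x d0; have := ltn_pmod y d0.
by case: odd; lia.
Qed.

Lemma ltn_label (d x y : nat) :
  0 < d -> label d x = label d y -> (x < y) = (x %/ d < y %/ d).
Proof.
move=> d0 L; have [lt|lt|E] := ltngtP (x %/ d) (y %/ d).
- by rewrite ltnNge; apply: contraTN lt => /(leq_div2r d); rewrite -leqNgt.
- apply/negbTE; rewrite -leqNgt ltnW // ltnNge.
  by apply: contraTN lt => /(leq_div2r d); rewrite -leqNgt.
- by rewrite (label_inj d0 E L) ltnn.
Qed.

Lemma restr_same_block (d m : nat) (pi : {set {set 'I_(2 * d * m)}})
    (i : 'I_d) (a b : 'I_(2 * m)) :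
  reflect (exists x y : 'I_(2 * d * m),
     [/\ label d x = i, x %/ d = a, label d y = i, y %/ d = b &
        same_block pi x y])
    (same_block (restr_label pi i) a b).
Proof.
apply: (iffP exists_inP) => [[C]|[x [y [lx xa ly yb /exists_inP[B Bpi /andP[xB yB]]]]]].
  rewrite !inE => /andP[_ /imsetP[B Bpi ->]]; rewrite !inE.
  case/andP => /exists_inP[x xB /andP[/eqP lx /eqP xa]].
  case/exists_inP => y yB /andP[/eqP ly /eqP yb].
  exists x, y; split=> //; apply/exists_inP; exists B => //.
  by rewrite xB.
set C := [set k : 'I_(2 * m) | [exists x in B, (label d x == i) && (x %/ d == k)]].
have aC : a \in C by rewrite inE; apply/exists_inP; exists x; rewrite // lx xa !eqxx.
have bC : b \in C by rewrite inE; apply/exists_inP; exists y; rewrite // ly yb !eqxx.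
exists C; last by rewrite aC.
rewrite !inE; apply/andP; split; first by apply/set0Pn; exists a.
by apply/imsetP; exists B.
Qed.

Lemma Phi_relP (d m : nat) (pi : {set {set 'I_(2 * d * m)}}) (i : 'I_d)
    (k l : 'I_m) :
  reflect (exists x y : 'I_(2 * d * m),
     [/\ label d x = i, (x %/ d)./2 = k, label d y = i, (y %/ d)./2 = l &
        same_block pi x y])
    (Phi_rel (restr_label pi i) k l).
Proof.
apply: (iffP existsP) => [[a /existsP[b /and3P[/eqP ak /eqP bl]]]|].
  case/restr_same_block => x [y [lx xa ly yb xy]].
  by exists x, y; rewrite xa yb.
case=> x [y [lx xa ly yb xy]]; exists (Ordinal (divn_lt x)).
apply/existsP; exists (Ordinal (divn_lt y)); rewrite /= xa yb !eqxx /=.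
by apply/restr_same_block; exists x, y.
Qed.

Lemma Phi_rel_sym (m : nat) (rho : {set {set 'I_(2 * m)}}) :
  symmetric (Phi_rel rho).
Proof.
by move=> k l; apply/existsP/existsP => -[p /existsP[q /and3P[kp lq pq]]];
  exists q; apply/existsP; exists p; rewrite kp lq same_block_sym.
Qed.

Lemma Phi_connect (m : nat) (rho tau : {set {set 'I_(2 * m)}}) :
  Phi rho = Phi tau -> connect (Phi_rel rho) =2 connect (Phi_rel tau).
Proof.
have eqv r : {in [set: 'I_m] & &, equivalence_rel (connect (@Phi_rel m r))}.
  move=> x y z _ _ _; apply: (equivalence_relP _).2; split; first exact: connect0.
  move=> a b; apply: same_connect.
  exact/sym_connect_sym/Phi_rel_sym.
move=> E k l.
have pb (r : {set {set 'I_(2 * m)}}) :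
    connect (Phi_rel r) k l = (l \in pblock (Phi r) k).
  by rewrite /Phi (pblock_equivalence_partition (eqv r)).
by rewrite !pb E.
Qed.

(** If neither of [l] and [l'] precedes the other when going cyclically upwards
    from [k], where [k] itself comes last, they are equal. *)
Lemma in_gap_antisym (k l l' : nat) :
  ~~ in_gap k l l' -> ~~ in_gap k l' l -> l = l'.
Proof. by rewrite /in_gap; case: (ltnP k l); case: (ltnP k l') => /=; lia. Qed.

(** Gaps from an odd to an even number contain both or none of [2j], [2j + 1]. *)
Lemma in_gap_half (a b c : nat) :
  odd a -> ~~ odd b -> in_gap a b c = in_gap a./2 b./2 c./2.
Proof.
move=> oa ob; rewrite /in_gap.
have := odd_double_half a; have := odd_double_half b; have := odd_double_half c.
rewrite oa (negbTE ob) => Ec Eb Ea.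
have -> : (a < b) = (a./2 < b./2) by lia.
have -> : (c < b) = (c./2 < b./2) by case: (odd c) Ec; lia.
by have -> : (a < c) = (a./2 < c./2) by case: (odd c) Ec; lia.
Qed.

(** For [x] a down element in the group [k] and [y] its cyclic successor, the
    group [l] of [y] is in the class of [k] for Phi(pi|A_i), and the gap from
    [k] to [l] contains no element of this class. *)
Lemma Phi_gap (d m : nat) (pi : {set {set 'I_(2 * d * m)}}) (i : 'I_d)
    (x y : 'I_(2 * d * m)) (k l : 'I_m) :
  0 < d -> pi \in NCstar d m -> cnext pi x y -> ~~ up d x -> label d x = i ->
  (x %/ d)./2 = k -> (y %/ d)./2 = l ->
  connect (Phi_rel (restr_label pi i)) k l /\
  forall j : 'I_m, connect (Phi_rel (restr_label pi i)) k j -> ~~ in_gap k l j.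
Proof.
move=> d0 pi_in nxy xdown lx xk yl; have [P N _ _] := NCstarP pi_in.
have xy := nxy.1.
have ly : label d y = i by rewrite -lx; apply/esym/(label_same_block d0 pi_in).
have yup : up d y.
  by have := cnext_up pi_in nxy; rewrite (negbTE xdown); case: (up d y).
have gapE z : label d z = i -> in_gap x y z = in_gap k l (z %/ d)./2.
  move=> lz.
  have -> : in_gap x y z = in_gap (x %/ d) (y %/ d) (z %/ d).
    by rewrite /in_gap -!(@ltn_label d) ?lx ?ly ?lz.
  by rewrite -xk -yl; apply: in_gap_half => //; move: xdown; rewrite negbK.
split; first by apply/connect1/Phi_relP; exists x, y.
have closed_gap :
    closed (Phi_rel (restr_label pi i)) (fun j : 'I_m => in_gap k l j).
  apply: intro_closed; first exact/sym_connect_sym/Phi_rel_sym.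
  move=> j j' /Phi_relP[z [w [lz zj lw wj zw]]]; rewrite !unfold_in -zj -wj.
  by rewrite -!gapE // => zg; apply: gap_closed nxy zg zw.
(* k itself is not in the gap from k to l. *)
move=> j kj; have := closed_connect closed_gap kj; rewrite !unfold_in => <-.
by rewrite /in_gap ltnn orbF; case: (ltnP k l) => // ?; rewrite ltnNge negbK.
Qed.

(** * Comparison of pi with the pairing sigma *)

Lemma NC2starP (d m : nat) (sigma : {set {set 'I_(2 * d * m)}}) :
  sigma \in NC2star d m ->
  sigma \in NCstar d m /\ forall B, B \in sigma -> #|B| = 2.
Proof.
by rewrite inE => /andP[S /forall_inP H]; split=> // B /H/eqP.
Qed.

Lemma cnext_pair (d m : nat) (sigma : {set {set 'I_(2 * d * m)}}) x y :
  sigma \in NC2star d m -> same_block sigma x y -> x != y -> cnext sigma x y.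
Proof.
move=> /NC2starP[/NCstarP[P _ _ _] two] xy nxy; split=> // z xz.
have /exists_inP[B Bs /andP[xB yB]] := xy.
have zB : z \in B by rewrite -(same_block_mem _ P Bs xB).
have : z \in [set x; y].
  suff <- : B = [set x; y] by [].
  by apply/esym/eqP; rewrite eqEcard cards2 nxy two // subUset !sub1set xB yB.
rewrite !inE => /orP[] /eqP->; rewrite /in_gap; case: ltnP => // _;
  by rewrite ?ltnn ?andbF ?orbF // -leqNgt.
Qed.

(** The partitions of NC*(d, m) with the same image as [sigma] under P. *)
Definition fibre (d m : nat) (sigma : {set {set 'I_(2 * d * m)}}) :
    {set {set {set 'I_(2 * d * m)}}} :=
  [set pi in NCstar d m | calP pi == calP sigma].

Lemma calPE (d m : nat) (pi : {set {set 'I_(2 * d * m)}}) (i : 'I_d) :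
  calP pi i = Phi (restr_label pi i).
Proof. exact: ffunE. Qed.

Lemma fibre_NCstar (d m : nat) (sigma pi : {set {set 'I_(2 * d * m)}}) :
  pi \in fibre sigma -> pi \in NCstar d m.
Proof. by case/setIdP. Qed.

(** The cyclic successor of a down element in its [pi]-block is its partner in
    the pairing [sigma]. *)
Lemma down_cnext (d m : nat) (sigma pi : {set {set 'I_(2 * d * m)}}) x y :
  0 < d -> sigma \in NC2star d m -> pi \in fibre sigma ->
  same_block sigma x y -> x != y -> ~~ up d x -> cnext pi x y.
Proof.
move=> d0 s_in pi_in xy nxy xdown; have [piN E] := setIdP pi_in.
have [sN _] := NC2starP s_in; have [P _ _ _] := NCstarP piN.
have sxy := cnext_pair s_in xy nxy.
have [y' pxy'] := cnext_exists x P.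
suff -> : y = y' by [].
pose i := Ordinal (label_lt x d0).
have hk (z : 'I_(2 * d * m)) : (z %/ d)./2 < m.
  by rewrite ltn_half_double -mul2n divn_lt.
(* gr z is the index of the group that contains the interval of z. *)
pose gr z := Ordinal (hk z).
have Ei : connect (Phi_rel (restr_label pi i))
    =2 connect (Phi_rel (restr_label sigma i)).
  by apply: Phi_connect; rewrite -!calPE (eqP E).
have [s1 s2] := @Phi_gap d m sigma i x y (gr x) (gr y)
  d0 sN sxy xdown erefl erefl erefl.
have [p1 p2] := @Phi_gap d m pi i x y' (gr x) (gr y')
  d0 piN pxy' xdown erefl erefl erefl.
have g1 : ~~ in_gap (gr x) (gr y) (gr y') by apply: s2; rewrite -Ei.
have g2 : ~~ in_gap (gr x) (gr y') (gr y) by apply: p2; rewrite Ei.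
have eqg : (y %/ d)./2 = (y' %/ d)./2.
  exact: in_gap_antisym g1 g2.
have yup := cnext_up sN sxy; have y'up := cnext_up piN pxy'.
have ly := label_same_block d0 sN xy.
have ly' := label_same_block d0 piN pxy'.1.
apply/val_inj/(label_inj d0); last by rewrite -ly -ly'.
move: yup y'up; rewrite (negbTE xdown) /up => /= o1 o2.
rewrite -[LHS]odd_double_half -[RHS]odd_double_half eqg.
by case: (odd _) o1; case: (odd _) o2.
Qed.

Lemma pair_partner (d m : nat) (sigma : {set {set 'I_(2 * d * m)}})
    (x : 'I_(2 * d * m)) :
  sigma \in NC2star d m ->
  exists y, [/\ same_block sigma x y, x != y & up d x != up d y].
Proof.
move=> s_in; have [sN two] := NC2starP s_in; have [P _ _ _] := NCstarP sN.
have /exists_inP[B Bs /andP[xB _]] := same_block_refl x P.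
have : 0 < #|B :\ x| by have := cardsD1 x B; rewrite xB two //; lia.
case/card_gt0P => y; rewrite !inE => /andP[yx yB].
have xy : same_block sigma x y by rewrite (same_block_mem _ P Bs xB).
by exists y; rewrite eq_sym yx (cnext_up sN) //; apply: cnext_pair; rewrite // eq_sym.
Qed.

(** The pairing [sigma] is finer than [pi]. *)
Lemma pair_same_block (d m : nat) (sigma pi : {set {set 'I_(2 * d * m)}})
    (x y : 'I_(2 * d * m)) :
  0 < d -> sigma \in NC2star d m -> pi \in fibre sigma ->
  same_block sigma x y -> same_block pi x y.
Proof.
move=> d0 s_in pi_in; have [P _ _ _] := NCstarP (fibre_NCstar pi_in).
have [->|nxy] := eqVneq x y; first by move=> _; apply: same_block_refl.
move=> xy; have [sN _] := NC2starP s_in.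
have [xup|xdown] := boolP (up d x); last first.
  by have [] := down_cnext d0 s_in pi_in xy nxy xdown.
have ydown : ~~ up d y.
  by have := cnext_up sN (cnext_pair s_in xy nxy); rewrite xup; case: (up d y).
rewrite same_block_sym in xy; rewrite eq_sym in nxy.
by have [+ _] := down_cnext d0 s_in pi_in xy nxy ydown; rewrite same_block_sym.
Qed.

Lemma block_max_sub (n : nat) (sigma pi : {set {set 'I_n}}) x :
  (forall y, same_block sigma x y -> same_block pi x y) ->
  block_max pi x -> block_max sigma x.
Proof.
move=> sub /forallP M; apply/forallP => y; apply/implyP => /sub xy.
by have := M y; rewrite xy.
Qed.

Lemma block_min_sub (n : nat) (sigma pi : {set {set 'I_n}}) x :
  (forall y, same_block sigma x y -> same_block pi x y) ->
  block_min pi x -> block_min sigma x.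
Proof.
move=> sub /forallP M; apply/forallP => y; apply/implyP => /sub xy.
by have := M y; rewrite xy.
Qed.

Lemma down_block_max (d m : nat) (sigma pi : {set {set 'I_(2 * d * m)}})
    (x : 'I_(2 * d * m)) :
  0 < d -> sigma \in NC2star d m -> pi \in fibre sigma ->
  ~~ up d x -> block_max sigma x -> block_max pi x.
Proof.
move=> d0 s_in pi_in xdown /forallP M.
have [y [xy nxy _]] := pair_partner x s_in.
have [_ G] := down_cnext d0 s_in pi_in xy nxy xdown.
have := M y; rewrite xy /= => yx.
apply/forallP => z; apply/implyP => /G.
by rewrite /in_gap ltnNge yx /= negb_or -!leqNgt => /andP[].
Qed.

Lemma up_block_min (d m : nat) (sigma pi : {set {set 'I_(2 * d * m)}})
    (y : 'I_(2 * d * m)) :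
  0 < d -> sigma \in NC2star d m -> pi \in fibre sigma ->
  up d y -> block_min sigma y -> block_min pi y.
Proof.
move=> d0 s_in pi_in yup /forallP M; have [P _ _ _] := NCstarP (fibre_NCstar pi_in).
have [x [yx nyx]] := pair_partner y s_in; rewrite yup eq_sym eqb_id => xdown.
have := M x; rewrite yx /= => lexy.
rewrite same_block_sym in yx; rewrite eq_sym in nyx.
have [xy G] := down_cnext d0 s_in pi_in yx nyx xdown.
apply/forallP => z; apply/implyP => yz.
have /G : same_block pi x z by apply: (same_block_trans P xy).
by rewrite /in_gap ltnNge lexy /= negb_or -!leqNgt => /andP[].
Qed.

(** [x] lies in the [pi]-gap that follows [x'], and so does its partner in
    [sigma], which is not in the interval of [x] and [x']; hence it is larger
    than [x]. *)
Lemma not_block_max_right (d m : nat) (sigma pi : {set {set 'I_(2 * d * m)}})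
    (x x' : 'I_(2 * d * m)) :
  0 < d -> sigma \in NC2star d m -> pi \in fibre sigma ->
  x' %/ d = x %/ d -> x' < x -> ~~ block_max pi x' -> ~~ block_max sigma x.
Proof.
move=> d0 s_in pi_in J lt /cnext_gt[y x'y nxy].
have [P N _ _] := NCstarP (fibre_NCstar pi_in).
have Jy : x' %/ d < y %/ d.
  rewrite ltn_neqAle (leq_div2r d (ltnW x'y)) andbT.
  by apply: contraNneq (cnext_up (fibre_NCstar pi_in) nxy) => Jy; rewrite /up Jy.
have [z [xz _ upz]] := pair_partner x s_in.
have xy : x < y.
  by rewrite ltnNge; apply: contraTN Jy => /(leq_div2r d); rewrite J -leqNgt.
have : in_gap x' y z.
  apply: (gap_closed P N nxy (z := x)); first by rewrite /in_gap x'y lt xy.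
  exact: pair_same_block pi_in xz.
rewrite /in_gap x'y => /andP[x'z zy].
apply/negP => /forallP/(_ z); rewrite xz /= => zx.
suff Jz : z %/ d = x %/ d by move: upz; rewrite /up Jz eqxx.
by apply/eqP; rewrite eqn_leq (leq_div2r d zx) -J (leq_div2r d (ltnW x'z)).
Qed.

Lemma not_block_min_left (d m : nat) (sigma pi : {set {set 'I_(2 * d * m)}})
    (x x' : 'I_(2 * d * m)) :
  0 < d -> sigma \in NC2star d m -> pi \in fibre sigma ->
  x' %/ d = x %/ d -> x < x' -> ~~ block_min pi x' -> ~~ block_min sigma x.
Proof.
move=> d0 s_in pi_in J lt; have [P N _ _] := NCstarP (fibre_NCstar pi_in).
case/(cnext_lt P) => y yx' nyx.
have Jy : y %/ d < x' %/ d.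
  rewrite ltn_neqAle (leq_div2r d (ltnW yx')) andbT.
  by apply: contraNneq (cnext_up (fibre_NCstar pi_in) nyx) => Jy; rewrite /up Jy.
have [z [xz _ upz]] := pair_partner x s_in.
have yx : y < x.
  by rewrite ltnNge; apply: contraTN Jy => /(leq_div2r d); rewrite J -leqNgt.
have : in_gap y x' z.
  apply: (gap_closed P N nyx (z := x)); first by rewrite /in_gap yx' lt yx.
  exact: pair_same_block pi_in xz.
rewrite /in_gap yx' => /andP[yz zx'].
apply/negP => /forallP/(_ z); rewrite xz /= => xlez.
suff Jz : z %/ d = x %/ d by move: upz; rewrite /up Jz eqxx.
by apply/eqP; rewrite eqn_leq (leq_div2r d xlez) -J (leq_div2r d (ltnW zx')).
Qed.

(** * Counting the partitions *)

(** [x] is the maximum, or the minimum, of its block for [sigma] and not for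
    [pi]. *)
Definition changed (n : nat) (sigma pi : {set {set 'I_n}}) (x : 'I_n) : bool :=
  (block_max sigma x && ~~ block_max pi x) ||
  (block_min sigma x && ~~ block_min pi x).

Lemma changed_up (d m : nat) (sigma pi : {set {set 'I_(2 * d * m)}})
    (x : 'I_(2 * d * m)) :
  0 < d -> sigma \in NC2star d m -> pi \in fibre sigma ->
  up d x -> changed sigma pi x = block_max sigma x && ~~ block_max pi x.
Proof.
move=> d0 s_in pi_in xup; rewrite /changed.
case sm: (block_min sigma x); last by rewrite orbF.
by rewrite (up_block_min d0 s_in pi_in xup sm) orbF.
Qed.

Lemma changed_down (d m : nat) (sigma pi : {set {set 'I_(2 * d * m)}})
    (x : 'I_(2 * d * m)) :
  0 < d -> sigma \in NC2star d m -> pi \in fibre sigma ->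
  ~~ up d x -> changed sigma pi x = block_min sigma x && ~~ block_min pi x.
Proof.
move=> d0 s_in pi_in xdown; rewrite /changed.
case sm: (block_max sigma x); last by [].
by rewrite (down_block_max d0 s_in pi_in xdown sm).
Qed.

(** Whatever the partitions of the fibre, all the elements that they change in a
    given interval are equal. *)
Lemma changed_unique (d m : nat) (sigma pi rho : {set {set 'I_(2 * d * m)}})
    (x y : 'I_(2 * d * m)) :
  0 < d -> sigma \in NC2star d m ->
  pi \in fibre sigma -> rho \in fibre sigma ->
  x %/ d = y %/ d -> changed sigma pi x -> changed sigma rho y -> x = y.
Proof.
move=> d0 s_in; wlog lt : pi rho x y / x < y.
  move=> W p_in r_in J cx cy; apply/val_inj/eqP.
  have [lt|lt|_] := ltngtP (val x) (val y); last by [].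
    by move: (lt); rewrite (W pi rho x y lt p_in r_in J cx cy) ltnn.
  by move: (lt); rewrite (W rho pi y x lt r_in p_in (esym J) cy cx) ltnn.
move=> p_in r_in J cx cy; exfalso.
have eqU : up d x = up d y by rewrite /up J.
have [xup|xdown] := boolP (up d x).
  move: cx cy; rewrite !changed_up // -?eqU // => /andP[_ nx] /andP[sy _].
  by have := not_block_max_right d0 s_in p_in J lt nx; rewrite sy.
move: cx cy; rewrite !changed_down // -?eqU // => /andP[sx _] /andP[_ ny].
by have := not_block_min_left d0 s_in r_in (esym J) lt ny; rewrite sx.
Qed.

Lemma block_max_changed (d m : nat) (sigma pi : {set {set 'I_(2 * d * m)}})
    (x : 'I_(2 * d * m)) :
  0 < d -> sigma \in NC2star d m -> pi \in fibre sigma ->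
  block_max pi x = block_max sigma x && ~~ (up d x && changed sigma pi x).
Proof.
move=> d0 s_in pi_in.
have sub := @block_max_sub _ sigma pi x (fun y => pair_same_block d0 s_in pi_in).
have [xup|xdown] := boolP (up d x).
  rewrite changed_up //=.
  by case: (block_max pi x) sub => [->|_] //; case: (block_max sigma x).
rewrite andbT; apply/idP/idP => //; exact: down_block_max pi_in xdown.
Qed.

Lemma block_min_changed (d m : nat) (sigma pi : {set {set 'I_(2 * d * m)}})
    (x : 'I_(2 * d * m)) :
  0 < d -> sigma \in NC2star d m -> pi \in fibre sigma ->
  block_min pi x = block_min sigma x && ~~ (~~ up d x && changed sigma pi x).
Proof.
move=> d0 s_in pi_in.
have sub := @block_min_sub _ sigma pi x (fun y => pair_same_block d0 s_in pi_in).
have [xup|xdown] := boolP (up d x).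
  rewrite andbT; apply/idP/idP => //; exact: up_block_min pi_in xup.
rewrite changed_down //=.
by case: (block_min pi x) sub => [->|_] //; case: (block_min sigma x).
Qed.

(** The intervals that contain a changed element; they determine the partition
    within the fibre of [sigma]. *)
Definition changed_intervals (d m : nat) (sigma pi : {set {set 'I_(2 * d * m)}}) :
    {set 'I_(2 * m)} :=
  [set k : 'I_(2 * m) | [exists x, changed sigma pi x && (x %/ d == k :> nat)]].

Lemma changed_intervals_inj (d m : nat) (sigma pi rho : {set {set 'I_(2 * d * m)}}) :
  0 < d -> sigma \in NC2star d m ->
  pi \in fibre sigma -> rho \in fibre sigma ->
  changed_intervals sigma pi = changed_intervals sigma rho -> pi = rho.
Proof.
move=> d0 s_in p_in r_in EJ.
have sub p r : p \in fibre sigma -> r \in fibre sigma ->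
    changed_intervals sigma p = changed_intervals sigma r ->
    forall x, changed sigma p x -> changed sigma r x.
  move=> p_in' r_in' /setP EJ' x cx.
  have := EJ' (Ordinal (divn_lt x)); rewrite !inE.
  have -> : [exists y, changed sigma p y && (y %/ d == Ordinal (divn_lt x) :> nat)].
    by apply/existsP; exists x; rewrite cx /=.
  move/esym/existsP => [y /andP[cy /eqP J]].
  by rewrite (changed_unique d0 s_in p_in' r_in' (esym J) cx cy).
have EC x : changed sigma pi x = changed sigma rho x.
  by apply/idP/idP; apply: sub.
have [P N _ _] := NCstarP (fibre_NCstar p_in).
have [R M _ _] := NCstarP (fibre_NCstar r_in).
apply: eq_noncrossing => // x.
  by rewrite (block_max_changed _ d0 s_in p_in) EC -block_max_changed.
by rewrite (block_min_changed _ d0 s_in p_in) EC -block_min_changed.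
Qed.

(** * Counting the blocks *)

Lemma card_block_max (n : nat) (pi : {set {set 'I_n}}) :
  partition pi [set: 'I_n] -> #|[set x | block_max pi x]| = #|pi|.
Proof.
move=> P; have [/eqP cov triv n0] := and3P P.
have imE : pi = [set pblock pi x | x in [set x | block_max pi x]].
  apply/setP=> B; apply/idP/imsetP => [Bpi|[x _ ->]]; last first.
    by rewrite pblock_mem // cov inE.
  have /set0Pn[x0 x0B] : B != set0 by apply: contraNneq n0 => <-.
  case: (arg_maxnP (fun x : 'I_n => nat_of_ord x) x0B) => x xB xmax.
  exists x; last by rewrite (def_pblock triv Bpi xB).
  rewrite inE; apply/forallP => y; apply/implyP.
  by rewrite (same_block_mem _ P Bpi xB); apply: xmax.
rewrite [in RHS]imE card_in_imset // => x y.
rewrite !inE => /forallP xmax /forallP ymax eqB.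
have xy : same_block pi x y by rewrite same_blockE // eqB mem_pblock cov inE.
apply/val_inj/eqP; rewrite eqn_leq.
have := ymax x; rewrite same_block_sym xy /= => ->.
by have := xmax y; rewrite xy.
Qed.

Lemma card_NC2star (d m : nat) (sigma : {set {set 'I_(2 * d * m)}}) :
  sigma \in NC2star d m -> #|sigma| = d * m.
Proof.
move=> s_in; have [/NCstarP[P _ _ _] two] := NC2starP s_in.
have := card_uniform_partition two P; rewrite cardsT card_ord; lia.
Qed.

(** At most one maximum of a pair is no longer a maximum for [pi] in each of the
    [m] intervals of up elements, and none in the first one, whose elements are
    smaller than their partners. *)
Lemma card_merged (d m : nat) (sigma pi : {set {set 'I_(2 * d * m)}}) :
  0 < d -> sigma \in NC2star d m -> pi \in fibre sigma ->
  #|[set x | block_max sigma x] :\: [set x | block_max pi x]| <= m.-1.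
Proof.
move=> d0 s_in pi_in; set C := _ :\: _.
have CP x : x \in C -> [/\ up d x, changed sigma pi x & block_max sigma x].
  rewrite !inE => /andP[npx sx].
  have xup : up d x by apply: contraNT npx => xdown; apply: down_block_max pi_in xdown sx.
  by rewrite changed_up // npx sx.
rewrite cardE -(size_map (fun x : 'I_(2 * d * m) => (x %/ d)./2)) -(size_iota 1 m.-1).
apply: uniq_leq_size.
  rewrite map_inj_in_uniq ?enum_uniq // => x y; rewrite !mem_enum => xC yC eq2.
  have [xup cx _] := CP x xC; have [yup cy _] := CP y yC.
  apply: changed_unique cx cy => //.
  by rewrite -[LHS]odd_double_half -[RHS]odd_double_half eq2 (negbTE xup) (negbTE yup).
move=> k /mapP[x]; rewrite mem_enum => xC ->; have [xup _ /forallP M] := CP x xC.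
have [y [xy _ upy]] := pair_partner x s_in; have := M y; rewrite xy /= => yx.
have lt : y %/ d < x %/ d.
  rewrite ltn_neqAle (leq_div2r d yx) andbT.
  by apply: contraNneq upy => J; rewrite /up J.
have := odd_double_half (x %/ d); rewrite (negbTE xup) mem_iota.
by move: lt (divn_lt x); move: (x %/ d) (y %/ d); clear; lia.
Qed.

(** A block of even size has size 2 or at least 4. *)
Lemma card_pairs (n : nat) (pi : {set {set 'I_n}}) :
  partition pi [set: 'I_n] -> (forall B : {set 'I_n}, B \in pi -> ~~ odd #|B|) ->
  4 * #|pi| <= n + 2 * #|[set B in pi | #|B| == 2]|.
Proof.
move=> P E; have [_ _ n0] := and3P P.
have sz : \sum_(B in pi) #|B| = n by rewrite -(card_partition P) cardsT card_ord.
rewrite -[X in _ <= X + _]sz.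
have -> : #|[set B in pi | #|B| == 2]| = \sum_(B in pi) (#|B| == 2).
  rewrite -sum1_card big_mkcond [RHS]big_mkcond /=.
  by apply: eq_bigr => B _; rewrite inE; case: (B \in pi); case: eqP.
rewrite big_distrr -big_split /= mulnC -sum_nat_const; apply: leq_sum => B Bpi.
have := E B Bpi; have : #|B| != 0 by rewrite cards_eq0; apply: contraNneq n0 => <-.
by case: #|B| => [|[|[|[|k]]]] //= _ _; lia.
Qed.

Lemma card_fibre (d m : nat) (sigma : {set {set 'I_(2 * d * m)}}) :
  0 < d -> sigma \in NC2star d m -> #|fibre sigma| <= 2 ^ (2 * m).
Proof.
move=> d0 s_in.
have inj : {in fibre sigma &, injective (changed_intervals sigma)}.
  by move=> pi rho; apply: changed_intervals_inj.
rewrite -(card_in_imset inj) -[X in 2 ^ X]card_ord -cardsT -card_powerset.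
by rewrite powersetT subset_leq_card // subsetT.
Qed.

Lemma fibre_card_pairs (d m : nat) (sigma pi : {set {set 'I_(2 * d * m)}}) :
  0 < d -> 0 < m -> sigma \in NC2star d m -> pi \in fibre sigma ->
  d * m < #|[set B in pi | #|B| == 2]| + 2 * m.
Proof.
move=> d0 m0 s_in pi_in; have [P _ ev _] := NCstarP (fibre_NCstar pi_in).
have [sP _ _ _] := NCstarP (NC2starP s_in).1.
have sub : [set x | block_max pi x] \subset [set x | block_max sigma x].
  apply/subsetP=> x; rewrite !inE; apply: block_max_sub => y.
  exact: pair_same_block.
have := card_merged d0 s_in pi_in.
rewrite cardsDS // !card_block_max // card_NC2star //.
have := card_pairs P ev; move: #|_| #|_| => p b.
rewrite -mulnA; move: (d * m) => N; lia.
Qed.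

Lemma fibre_finer (d m : nat) (sigma pi : {set {set 'I_(2 * d * m)}}) :
  0 < d -> sigma \in NC2star d m -> pi \in fibre sigma -> finer sigma pi.
Proof.
move=> d0 s_in pi_in; have [P _ _ _] := NCstarP (fibre_NCstar pi_in).
have [sP _ _ _] := NCstarP (NC2starP s_in).1; have [_ _ n0] := and3P sP.
apply/forall_inP=> A As; have /set0Pn[x xA] : A != set0.
  by apply: contraNneq n0 => <-.
apply/exists_inP; exists (pblock pi x).
  by rewrite pblock_mem // (cover_partition P) inE.
apply/subsetP=> y yA; rewrite -same_blockE //.
by apply: (pair_same_block d0 s_in pi_in); rewrite (same_block_mem _ sP As).
Qed.

(** A block has a single label, hence at most one element in each interval. *)
Lemma card_block_le (d m : nat) (pi : {set {set 'I_(2 * d * m)}}) B :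
  0 < d -> pi \in NCstar d m -> B \in pi -> #|B| <= 2 * m.
Proof.
move=> d0 pi_in Bpi; pose q (x : 'I_(2 * d * m)) := Ordinal (divn_lt x).
rewrite -[leqRHS]card_ord; apply: (@leq_card_in _ _ q) => x y xB yB [J].
apply/val_inj/(label_inj d0 J); apply: (label_same_block d0 pi_in).
by apply/exists_inP; exists B; rewrite ?xB.
Qed.

Theorem theorem1p5 (d m : nat) (hd : 1 <= d) (hm : 1 <= m)
    (sigma : {set {set 'I_(2 * d * m)}}) (hsigma : sigma \in NC2star d m) :
  #|[set pi in NCstar d m | calP pi == calP sigma]| < 4 ^ (2 * m) /\
  (forall pi : {set {set 'I_(2 * d * m)}},
     pi \in NCstar d m -> calP pi = calP sigma ->
     [/\ finer sigma pi,
         ((d * m)%N%:Z - (2 * m)%N%:Z < #|[set B in pi | #|B| == 2]|%N%:Z)%R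
       & forall B : {set 'I_(2 * d * m)}, B \in pi -> #|B| <= 2 * m]).
Proof.
split=> [|pi piN E].
  apply: leq_ltn_trans (card_fibre hd hsigma) _.
  by rewrite ltn_exp2r // muln_gt0.
have pi_in : pi \in fibre sigma by rewrite inE piN E eqxx.
split; first exact: fibre_finer hd hsigma pi_in.
  have := fibre_card_pairs hd hm hsigma pi_in; clear.
  move: #|_| (d * m) (2 * m) => b N M; lia.
by move=> B; apply: card_block_le.
Qed.
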